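(* Suppose that $x,y\in\Phi$ are such that $x\ \mathrm{dom}_W\ y$. Then $x-y\in Q$, where $Q$ is the imaginary cone of $W$.
   Context: Coxeter datum. Let $V$ be a real vector space with a symmetric bilinear form $(\,,\,)$. For $A\subseteq V$, $\mathrm{PLC}(A)$ is the set of all (finite) sums $\sum_{a\in A}\lambda_a a$ with all $\lambda_a\ge 0$ and some $\lambda_{a'}>0$. A subset $\Delta\subseteq V$ is a root basis if (C1) $(a,a)=1$ for all $a\in\Delta$, and for distinct $a,b\in\Delta$ either $(a,b)=-\cos(\pi/m_{ab})$ for an integer $m_{ab}=m_{ba}\ge 2$, or $(a,b)\le -1$ (then $m_{ab}=m_{ba}=\infty$); (C2) $0\notin\mathrm{PLC}(\Delta)$. ($\Delta$ may be infinite or linearly dependent.) Fix such a Coxeter datum $(V,\Delta,(\,,\,))$. Let $(W,S)$, $S=\{r_a\mid a\in\Delta\}$, be the Coxeter system in which the $r_a$ are involutions and $r_ar_b$ has order $m_{ab}$; $W$ acts on $V$ (faithfully, preserving the form) by $r_a x=x-2(x,a)a$. Let $\Phi=\{wa\mid w\in W,a\in\Delta\}$, $\Phi^+=\Phi\cap\mathrm{PLC}(\Delta)$ (positive roots), $\Phi^-=-\Phi^+$ (negative roots); $\Phi$ is the disjoint union of $\Phi^+$ and $\Phi^-$. Dominance. For $x,y\in\Phi$, $x\ \mathrm{dom}_W\ y$ ($x$ dominates $y$) means $\{w\in W\mid wx\in\Phi^-\}\subseteq\{w\in W\mid wy\in\Phi^-\}$. Cones. Let $X=\mathrm{span}(\Delta)$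 and $X^*=\mathrm{Hom}(X,\mathbb R)$, with $W$ acting on $X^*$ by $(wf)(v)=f(w^{-1}v)$. Let $P=\mathrm{PLC}(\Delta)\cup\{0\}$ and $P^*=\{f\in X^*\mid f(v)\ge 0\text{ for all }v\in P\}$. The Tits cone is $U=\bigcup_{w\in W}wP^*\subseteq X^*$, and its dual is $U^*=\{v\in X\mid f(v)\ge 0\text{ for all }f\in U\}$. The imaginary cone of $W$ is $Q=\{v\in U^*\mid (v,a)\le 0\text{ for all but finitely many }a\in\Phi^+\}$. *)

(* Defs.v *)
From HB Require Import structures.
From mathcomp Require Import all_boot all_order all_algebra.
From mathcomp Require Import all_classical all_reals all_analysis.

Set Implicit Arguments.
Unset Strict Implicit.
Unset Printing Implicit Defensive.

Import Order.TTheory GRing.Theory Num.Theory.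
Local Open Scope classical_set_scope.
Local Open Scope ring_scope.

Section Cones.
Context {R : realType} {V : lmodType R}.
Implicit Types (A : set V) (v : V).

Definition plc A : set V :=
  [set v | exists (s : seq V) (c : V -> R),
    [/\ uniq s,
        (forall a, a \in s -> A a),
        (forall a, a \in s -> 0 <= c a),
        (exists2 a, a \in s & 0 < c a)
      & v = \sum_(a <- s) c a *: a]].

Definition lin_span A : set V :=
  [set v | exists (s : seq V) (c : V -> R),
    (forall a, a \in s -> A a) /\ v = \sum_(a <- s) c a *: a].

Lemma lin_span0 A : lin_span A 0.
Proof. by exists [::], (fun=> 0); split => //; rewrite big_nil. Qed.

Lemma lin_span_gen A a (k : R) : A a -> lin_span A (k *: a).
Proof.
move=> Aa; exists [:: a], (fun=> k); split; last by rewrite big_seq1.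
by move=> b; rewrite inE => /eqP ->.
Qed.

Lemma lin_spanZ A (k : R) v : lin_span A v -> lin_span A (k *: v).
Proof.
move=> [s [c [sA ->]]]; exists s, (fun a => k * c a); split => //.
by rewrite scaler_sumr; apply: eq_bigr => a _; rewrite scalerA.
Qed.

Lemma lin_spanD A u v : lin_span A u -> lin_span A v -> lin_span A (u + v).
Proof.
move=> [s [c [sA ->]]] [t [d [tA ->]]].
exists (undup (s ++ t)),
  (fun a => c a *+ count_mem a s + d a *+ count_mem a t); split.
  by move=> a; rewrite mem_undup mem_cat => /orP[/sA|/tA].
have key (r : seq V) (e : V -> R) : {subset r <= s ++ t} ->
    \sum_(a <- r) e a *: a =
    \sum_(a <- undup (s ++ t)) (e a *+ count_mem a r) *: a.
  elim: r => [|x r IHr] sub.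
    by rewrite big_nil big1 // => a _; rewrite /= mulr0n scale0r.
  rewrite big_cons IHr; last by move=> a ar; apply: sub; rewrite inE ar orbT.
  have xin : x \in undup (s ++ t).
    by rewrite mem_undup; apply: sub; rewrite inE eqxx.
  rewrite (bigD1_seq x) ?undup_uniq //= [RHS](bigD1_seq x) ?undup_uniq //=.
  rewrite eqxx mulrnDr scalerDl mulr1n -addrA; congr (_ + (_ + _)).
  by apply: eq_bigr => a /negbTE ax; rewrite eq_sym ax add0n.
rewrite (key s c) ?(key t d); try by move=> a ain; rewrite mem_cat ain ?orbT.
by rewrite -big_split; apply: eq_bigr => a _; rewrite scalerDl.
Qed.

End Cones.

Section RootBasis.
Context {R : realType} {V : lmodType R}.
Implicit Types (B : {symmetric V}) (Delta : set V).

Definition root_basis B Delta : Prop :=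
  [/\ (forall a, Delta a -> B a a = 1),
      (forall a b, Delta a -> Delta b -> a != b ->
         (exists2 m : nat, (2 <= m)%N & B a b = - cos (pi / m%:R))
         \/ B a b <= -1)
    & ~ plc Delta 0].

(* [coxeter_exponent B a b m]: the Coxeter matrix entry m_ab is finite and
   equal to m (with m_aa = 1); no m satisfies it when m_ab is infinite. *)
Definition coxeter_exponent B (a b : V) (m : nat) : Prop :=
  (a = b /\ m = 1%N)
  \/ [/\ a != b, (2 <= m)%N & B a b = - cos (pi / m%:R)].

Definition coxeter_relations B Delta (G : groupType) (f : V -> G) : Prop :=
  forall a b m, Delta a -> Delta b -> coxeter_exponent B a b m ->
    ((f a * f b) ^+ m = 1)%g.

(* W is presented by the generators [r a], a in Delta, and the Coxeter
   relations; the values of [r] outside Delta are irrelevant. *)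
Definition coxeter_system B Delta (W : groupType) (r : V -> W) : Prop :=
  [/\ (forall H : {pred W}, group_closed H ->
         (forall a, Delta a -> r a \in H) -> forall w, w \in H),
      coxeter_relations B Delta r
    & forall (G : groupType) (f : V -> G), coxeter_relations B Delta f ->
        exists h : {multiplicative W -> G}, forall a, Delta a -> h (r a) = f a].

End RootBasis.

Record coxeter_datum (R : realType) (V : lmodType R) := CoxeterDatum {
  cox_form : {symmetric V};
  cox_basis : set V;
  cox_basisP : root_basis cox_form cox_basis }.

(* The Coxeter group of a datum together with its action on V. *)
Record coxeter_group (R : realType) (V : lmodType R) (D : coxeter_datum V) :=
  CoxeterGroup {
    cox_group :> groupType;
    cox_refl : V -> cox_group;
    cox_systemP : coxeter_system (cox_form D) (cox_basis D) cox_refl;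
    cox_act : cox_group -> {linear V -> V};
    cox_act1 : forall v, cox_act 1%g v = v;
    cox_actM : forall g h v, cox_act (g * h)%g v = cox_act g (cox_act h v);
    cox_act_refl : forall a v, cox_basis D a ->
      cox_act (cox_refl a) v = v - (2 * cox_form D v a) *: a }.

Section Roots.
Context {R : realType} {V : lmodType R} {D : coxeter_datum V}.
Variable W : coxeter_group D.

Definition cox_root : set V :=
  [set x | exists (w : W) (a : V), cox_basis D a /\ x = cox_act w a].

Definition pos_root : set V := cox_root `&` plc (cox_basis D).

Definition neg_root : set V := [set - x | x in pos_root].

Definition dominates (x y : V) : Prop :=
  [set w : W | neg_root (cox_act w x)] `<=` [set w : W | neg_root (cox_act w y)].

End Roots.

Section SpanSpace.
Context {R : realType} {V : lmodType R} (D : coxeter_datum V).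

Definition span_pred : {pred V} := [pred v | `[< lin_span (cox_basis D) v >]].

Lemma span_predP v : reflect (lin_span (cox_basis D) v) (v \in span_pred).
Proof. exact: asboolP. Qed.

Lemma span_pred_submod_closed : submod_closed span_pred.
Proof.
split; first exact/span_predP/lin_span0.
move=> k u v /span_predP Su /span_predP Sv.
by apply/span_predP/lin_spanD => //; exact: lin_spanZ.
Qed.

HB.instance Definition _ :=
  GRing.isSubmodClosed.Build R V span_pred span_pred_submod_closed.

Record span_space := SpanSpace {
  span_val : V;
  span_valP : span_val \in span_pred }.

HB.instance Definition _ := [isSub for span_val].
HB.instance Definition _ := [Choice of span_space by <:].
HB.instance Definition _ := [SubChoice_isSubLmodule of span_space by <:].

End SpanSpace.

Section DualAction.
Context {R : realType} {V : lmodType R} {D : coxeter_datum V}.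
Variable W : coxeter_group D.
Local Notation X := (span_space D).

Lemma cox_act_span (w : W) (v : V) :
  v \in span_pred D -> cox_act w v \in span_pred D.
Proof.
have [gen rel _] := cox_systemP W.
pose H : {pred W} := [pred w | `[< forall v, v \in span_pred D ->
  cox_act w v \in span_pred D /\ cox_act w^-1%g v \in span_pred D >]].
have HP g : reflect (forall v, v \in span_pred D ->
    cox_act g v \in span_pred D /\ cox_act g^-1%g v \in span_pred D) (g \in H).
  exact: asboolP.
suff Hw : w \in H by move=> vX; have [] := HP _ Hw v vX.
apply: gen => [|a Da].
  split=> [|g h /HP Hg /HP Hh].
    by apply/HP => u uX; rewrite invg1 cox_act1.
  apply/HP => u uX; rewrite invgF !cox_actM.
  by split; [apply: (Hg _ (Hh _ uX).2).1 | apply: (Hh _ (Hg _ uX).2).1].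
have rV : (cox_refl W a)^-1%g = cox_refl W a.
  have /esym := rel a a 1%N Da Da (or_introl (conj erefl erefl)).
  rewrite expg1 => r1.
  by rewrite -[LHS]mulg1 r1 mulgA mulVg mul1g.
apply/HP => u uX; rewrite rV cox_act_refl //.
suff : u - (2 * cox_form D u a) *: a \in span_pred D by [].
rewrite -scaleNr; apply/span_predP/lin_spanD; first exact/span_predP.
exact: lin_span_gen.
Qed.

Definition span_act (w : W) (v : X) : X :=
  SpanSpace (cox_act_span w (span_valP v)).

Lemma span_act_is_linear (w : W) : linear (span_act w).
Proof. by move=> k u v; apply/val_inj; rewrite /= !linearP. Qed.

HB.instance Definition _ (w : W) :=
  GRing.isLinear.Build R X X _ (span_act w) (span_act_is_linear w).

Definition dual_act (w : W) (f : {scalar X}) : {scalar X} :=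
  f \o span_act w^-1%g.

End DualAction.

Section TitsCone.
Context {R : realType} {V : lmodType R} {D : coxeter_datum V}.
Variable W : coxeter_group D.
Local Notation X := (span_space D).

Definition pos_cone : set V := plc (cox_basis D) `|` [set 0].

Definition dual_pos_cone : set {scalar X} :=
  [set f | forall v : X, pos_cone (val v) -> 0 <= f v].

Definition tits_cone : set {scalar X} :=
  \bigcup_(w : W) [set dual_act w f | f in dual_pos_cone].

Definition dual_tits_cone : set X :=
  [set v | forall f, tits_cone f -> 0 <= f v].

(* The imaginary cone, viewed as a subset of V through X = span Delta <= V. *)
Definition imaginary_cone : set V :=
  [set val v | v in [set v : X | dual_tits_cone v /\
    finite_set [set a | pos_root W a /\ ~ cox_form D (val v) a <= 0]]].

End TitsCone.

(* Main.v *)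
Require Import Defs.
From HB Require Import structures.
From mathcomp Require Import all_boot all_order all_algebra.
From mathcomp Require Import all_classical all_reals all_analysis.
From mathcomp Require Import ring lra zify.
Import Order.TTheory GRing.Theory Num.Theory.
Local Open Scope classical_set_scope.
Local Open Scope ring_scope.

Set Implicit Arguments.
Unset Strict Implicit.
Unset Printing Implicit Defensive.

(* If x dom y, then in the plane of x and y dominance forces (x, y) >= 1.
   Let f be nonnegative on Delta with f(x) < f(y) (and f(y) > 0, up to replacing
   the pair by (-y, -x)). Some point f' of the segment from f to r_y f satisfies
   f'(x) < 0 < f'(y); since f' is negative on finitely many positive roots it is
   in the Tits cone, say f' = w g with g nonnegative on Delta, so w^-1 x is
   negative and w^-1 y positive, a contradiction. Dominance being W-invariant,
   x - y is in U*.
   For the finiteness condition, move by W to x positive and y = -z negative, so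
   that (x, z) <= -1. As long as (x + z, a) > 0 for a simple root a, replace x, z
   by r_a x, r_a z: both stay positive, x + z decreases, and the sum of the
   lengths of the reflections r_x, r_z does not increase. All this happens in a
   finitely generated parabolic subgroup, so it stops at some w(x - y) having
   nonpositive product with every positive root; then (x - y, b) > 0 with b
   positive forces wb to be negative, which leaves finitely many b. *)

(** * Dihedral coefficients *)

Section DihedralCoefficients.
Context {R : realType}.
Implicit Types (c t : R) (k m : nat).

(* Chebyshev polynomials of the second kind, shifted so that
   [dihedral_coef (cos t) k = sin (k t) / sin t]. *)
Fixpoint dihedral_coef c k : R :=
  if k is k1.+1 then
    if k1 is k2.+1 then 2 * c * dihedral_coef c k1 - dihedral_coef c k2 else 1
  else 0.
Local Notation p := dihedral_coef.

Lemma dihedral_coefSS c k : p c k.+2 = 2 * c * p c k.+1 - p c k.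
Proof. by []. Qed.

(** The sequence is nondecreasing: for c >= 1 its increments satisfy p_(k+2) - p_(k+1) >= p_(k+1) -
    p_k. *)
Lemma dihedral_coef_ge0 c k : 1 <= c -> 0 <= p c k.
Proof.
move=> c1; suff [] : 0 <= p c k /\ p c k <= p c k.+1 by [].
elim: k => [|k [IH1 IH2]]; first by split=> /=; lra.
split; first exact: le_trans IH2.
by rewrite dihedral_coefSS; nra.
Qed.

Lemma dihedral_coef_sin t k : p (cos t) k * sin t = sin (k%:R * t).
Proof.
suff [] : p (cos t) k * sin t = sin (k%:R * t) /\
    p (cos t) k.+1 * sin t = sin (k.+1%:R * t) by [].
elim: k => [|k [IH1 IH2]]; first by rewrite /= !mul0r sin0 !mul1r.
split=> //; rewrite dihedral_coefSS mulrBl -(mulrA (2 * _)) IH2 IH1.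
have -> : k.+2%:R * t = k.+1%:R * t + t by rewrite -[in LHS]natr1; ring.
have -> : k%:R * t = k.+1%:R * t - t by rewrite -[in RHS]natr1; ring.
by rewrite sinB sinD; ring.
Qed.

Lemma pi_div_itv m : (2 <= m)%N -> 0 < pi / m%:R :> R /\ pi / m%:R <= pi / 2 :> R.
Proof.
move=> m2; have pi0 := pi_gt0 R; split.
  by rewrite divr_gt0 // ltr0n; lia.
by rewrite ler_pM2l // lef_pV2 ?posrE ?ltr0n ?ler_nat //; lia.
Qed.

Lemma cos_pi_div_ge0 m : (2 <= m)%N -> 0 <= cos (pi / m%:R) :> R.
Proof.
move=> /pi_div_itv[t0 t1]; apply: cos_ge0_pihalf; apply/andP; split => //.
by apply: le_trans (ltW t0); have := pi_gt0 R; lra.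
Qed.

Lemma sin_pi_div_gt0 m : (2 <= m)%N -> 0 < sin (pi / m%:R) :> R.
Proof.
move=> /pi_div_itv[t0 t1]; apply: sin_gt0_pi; rewrite t0 /=.
by apply: le_lt_trans t1 _; have := pi_gt0 R; lra.
Qed.

Lemma dihedral_coef_cos_ge0 m k :
  (2 <= m)%N -> (k <= m)%N -> 0 <= p (cos (pi / m%:R)) k.
Proof.
move=> m2 km; have s0 := sin_pi_div_gt0 m2; have [t0 _] := pi_div_itv m2.
rewrite -(pmulr_lge0 _ s0) dihedral_coef_sin; apply: sin_ge0_pi.
rewrite mulr_ge0 ?ler0n ?(ltW t0) //=.
have m0 : 0 < m%:R :> R by rewrite ltr0n; lia.
rewrite mulrCA ler_piMr ?(ltW (pi_gt0 R)) // ler_pdivrMr // mul1r.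
by rewrite ler_nat.
Qed.

Lemma dihedral_coef_cosm m : (2 <= m)%N -> p (cos (pi / m%:R)) m = 0.
Proof.
move=> m2; have s0 := sin_pi_div_gt0 m2.
apply: (mulIf (lt0r_neq0 s0)); rewrite dihedral_coef_sin mul0r mulrC divfK.
  exact: sinpi.
by rewrite pnatr_eq0; lia.
Qed.

Lemma dihedral_coef_cosm1 m : (1 <= m)%N -> p (cos (pi / m.+1%:R)) m = 1.
Proof.
move=> m2; have s0 := @sin_pi_div_gt0 m.+1 m2.
apply: (mulIf (lt0r_neq0 s0)); rewrite dihedral_coef_sin mul1r.
have -> : m%:R * (pi / m.+1%:R) = pi - pi / m.+1%:R :> R.
  rewrite -natr1; field; by rewrite natr1 pnatr_eq0.
by rewrite sinB sinpi cospi; ring.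
Qed.

Lemma dihedral_coef_neg c : c < 1 -> exists k, 0 < p c k.+1 /\ p c k.+2 <= 0.
Proof.
move=> c1; apply: contrapT => nex.
have pos k : 0 < p c k.+1.
  elim: k => [|k IH]; first exact: ltr01.
  by rewrite ltNge; apply/negP => le0; apply: nex; exists k.
(* AM-GM: the ratios q_k of consecutive terms satisfy
   q_k - q_(k+1) = q_k + q_k^-1 - 2c >= 2 - 2c. *)
have bound k : p c k.+2 <= (2 * c - k%:R * (2 - 2 * c)) * p c k.+1.
  elim: k => [|k IH]; first by rewrite /=; lra.
  rewrite dihedral_coefSS -(natr1 k).
  move: IH (pos k) (pos k.+1); set q := p c k.+1; set q' := p c k.+2.
  set M := (2 * c - _) => IH q0 q'0.
  have -> : 2 * c - (k%:R + 1) * (2 - 2 * c) = 2 * c - (2 - M) by rewrite /M; ring.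
  rewrite mulrBl lerD2l lerN2.
  have [M2|M2] := lerP M 2; last by nra.
  apply: le_trans (_ : (2 - M) * (M * q) <= _); first by rewrite ler_wpM2l //; lra.
  have := sqr_ge0 (M - 1); nra.
have d0 : 0 < 2 - 2 * c by lra.
(* Any k above 2c / (2 - 2c) makes the factor in [bound] negative, against positivity. *)
have := archi_boundP (x := `|2 * c / (2 - 2 * c)|) (normr_ge0 _).
set k := Num.bound _ => kP.
have : 2 * c / (2 - 2 * c) < k%:R by apply: le_lt_trans kP; exact: ler_norm.
rewrite ltr_pdivrMr // => lt; have := bound k; have := pos k; have := pos k.+1.
nra.
Qed.

End DihedralCoefficients.

(** * Words of reflections and the sign of roots *)

Section ClosedCone.
Context {R : realType} {V : lmodType R}.
Implicit Types (A : set V) (u v : V).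

(** This is [plc A] with 0 adjoined, built one generator at a time so that proofs go by
    induction. *)
Inductive cone A : V -> Prop :=
| cone0 : cone A 0
| cone_cons a (k : R) v : A a -> 0 <= k -> cone A v -> cone A (k *: a + v).

Lemma cone_gen A a : A a -> cone A a.
Proof.
by move=> Aa; have := cone_cons Aa ler01 (cone0 A); rewrite scale1r addr0.
Qed.

Lemma coneD A u v : cone A u -> cone A v -> cone A (u + v).
Proof.
elim=> [|a k w Aa k0 _ IH] Cv; first by rewrite add0r.
by rewrite -addrA; apply: cone_cons => //; exact: IH.
Qed.

Lemma coneZ A (k : R) v : 0 <= k -> cone A v -> cone A (k *: v).
Proof.
move=> k0; elim=> [|a l w Aa l0 _ IH]; first by rewrite scaler0; exact: cone0.
by rewrite scalerDr scalerA; apply: cone_cons => //; exact: mulr_ge0.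
Qed.

Lemma cone_sub A A' v : A `<=` A' -> cone A v -> cone A' v.
Proof.
move=> sub; elim=> [|a k w Aa k0 _ IH]; first exact: cone0.
by apply: cone_cons => //; exact: sub.
Qed.

Lemma plc_cone A v : plc A v -> cone A v.
Proof.
move=> [s [c [_ sA c0 _ ->]]]; elim: s sA c0 => [|a s IH] sA c0.
  by rewrite big_nil; exact: cone0.
rewrite big_cons; apply: cone_cons.
- by apply: sA; rewrite mem_head.
- by apply: c0; rewrite mem_head.
- by apply: IH => b bs; [apply: sA|apply: c0]; rewrite inE bs orbT.
Qed.

(** The list in [plc] has no repetition, so the coefficient of a generator already listed is raised
    instead. *)
Lemma plc_cons A a (k : R) v : A a -> 0 <= k -> plc A v -> plc A (k *: a + v).
Proof.
move=> Aa k0 [s [c [us sA c0 [b bs cb] ->]]].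
have [ais|anis] := boolP (a \in s).
  exists s, (fun e => c e + (if e == a then k else 0)); split => //.
  - by move=> e es; case: ifP => _; rewrite ?addr0 ?addr_ge0 ?c0.
  - by exists b => //; case: ifP => _; rewrite ?addr0 ?ltr_wpDr.
  rewrite !(bigD1_seq a) //= eqxx scalerDl addrA (addrC (k *: a)); congr (_ + _).
  by apply: eq_bigr => e /negbTE ->; rewrite addr0.
exists (a :: s), (fun e => if e == a then k else c e); split => //=.
- by rewrite anis.
- by move=> e; rewrite inE => /predU1P[->|/sA].
- by move=> e; rewrite inE; case: eqP => //= _ /c0.
- exists b; first by rewrite inE bs orbT.
  by case: eqP => // ba; move: bs anis; rewrite ba => ->.
rewrite big_cons eqxx; congr (_ + _); rewrite !big_seq.
by apply: eq_bigr => e es; case: eqP => // ea; move: es anis; rewrite ea => ->.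
Qed.

Lemma cone_plc A v : cone A v -> v = 0 \/ plc A v.
Proof.
elim=> [|a k w Aa k0 _ [->|Pw]]; first by left.
  rewrite addr0; move: k0; rewrite le_eqVlt => /predU1P[<-|k0].
    by left; rewrite scale0r.
  right; exists [:: a], (fun=> k); split => //.
  - by move=> b; rewrite inE => /eqP ->.
  - by move=> b _; exact: ltW.
  - by exists a => //; rewrite inE.
  - by rewrite big_seq1.
by right; exact: plc_cons.
Qed.

Lemma plcDcone A u v : plc A u -> cone A v -> plc A (u + v).
Proof.
move=> Pu; elim=> [|a k w Aa k0 _ IH]; first by rewrite addr0.
by rewrite addrCA; exact: plc_cons.
Qed.

Lemma cone_span A v : cone A v -> lin_span A v.
Proof.
elim=> [|a k w Aa k0 _ IH]; first exact: lin_span0.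
by apply: lin_spanD => //; exact: lin_span_gen.
Qed.

End ClosedCone.

Section Reflections.
Context {R : realType} {V : lmodType R}.
Variable B : {symmetric V}.
Implicit Types (a b u v x y : V) (s t : seq V).

Lemma symformC u v : B u v = B v u.
Proof. by rewrite hermC /= expr0 mul1r. Qed.

Lemma symformZl (k : R) u v : B (k *: u) v = k * B u v.
Proof. by rewrite linearZl_LR. Qed.

Lemma symformZr (k : R) u v : B u (k *: v) = k * B u v.
Proof. by rewrite linearZr_LR. Qed.

Lemma symformDl u v w : B (u + v) w = B u w + B v w.
Proof. by rewrite -{1}[u]scale1r linearPl /= mul1r. Qed.

Definition reflection a v : V := v - (2 * B v a) *: a.

Local Notation refl := reflection.

Lemma refl_is_linear a : linear (refl a).
Proof.
move=> k u v; rewrite /reflection linearPl /= scalerBr scalerA.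
rewrite mulrDr scalerDl opprD addrACA.
by congr (_ - _ *: _ + _); ring.
Qed.

HB.instance Definition _ a :=
  GRing.isLinear.Build R V V *:%R (refl a) (refl_is_linear a).

Lemma refl_form a u v : B a a = 1 -> B (refl a u) (refl a v) = B u v.
Proof.
move=> aa; rewrite /reflection linearBl !linearBr /= !symformZl !symformZr.
by rewrite aa (symformC a v); ring.
Qed.

Lemma refl_self a : B a a = 1 -> refl a a = - a.
Proof.
move=> aa; rewrite /reflection aa mulr1 (scaler_nat 2) mulr2n opprD addrA subrr.
by rewrite add0r.
Qed.

Lemma reflK a : B a a = 1 -> involutive (refl a).
Proof.
move=> aa v; rewrite {2}/reflection linearB linearZ_LR /= refl_self // {1}/reflection.
by rewrite scalerN opprK subrK.
Qed.

Lemma refl_eq0 a v : B v a = 0 -> refl a v = v.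
Proof. by move=> va; rewrite /reflection va mulr0 scale0r subr0. Qed.

(** Words stand for group elements and are compared through their action on [V]; the group itself
    enters only at the end. *)
Definition word_act s v : V := foldr refl v s.
Local Notation wact := word_act.

Lemma wact_is_linear s : linear (wact s).
Proof. by move=> k u v; elim: s => //= a s ->; rewrite linearP. Qed.

HB.instance Definition _ s :=
  GRing.isLinear.Build R V V *:%R (wact s) (wact_is_linear s).

Lemma wact_cat s t v : wact (s ++ t) v = wact s (wact t v).
Proof. by rewrite /word_act foldr_cat. Qed.

Lemma wact_rcons s a v : wact (rcons s a) v = wact s (refl a v).
Proof. by rewrite /word_act foldr_rcons. Qed.

Lemma wact_cons a s v : wact (a :: s) v = refl a (wact s v).
Proof. by []. Qed.

End Reflections.

Definition word_over {V : eqType} (Delta : set V) (s : seq V) : Prop :=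
  forall a, a \in s -> Delta a.

Section Words.
Context {V : eqType} (Delta : set V).
Implicit Types s t : seq V.

Lemma over_cat s t : word_over Delta (s ++ t) <-> word_over Delta s /\ word_over Delta t.
Proof.
split=> [st|[os ot] a].
  by split=> a ain; apply: st; rewrite mem_cat ain ?orbT.
by rewrite mem_cat => /orP[/os|/ot].
Qed.

Lemma over_cons a s : word_over Delta (a :: s) <-> Delta a /\ word_over Delta s.
Proof.
split=> [st|[Da os] b].
  by split=> [|b bs]; apply: st; rewrite inE ?eqxx ?bs ?orbT.
by rewrite inE => /predU1P[->|/os].
Qed.

Lemma over_rcons a s : word_over Delta (rcons s a) <-> Delta a /\ word_over Delta s.
Proof. by rewrite -cats1 over_cat over_cons; split=> [[? []]|[]]. Qed.

Lemma over_rev s : word_over Delta s -> word_over Delta (rev s).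
Proof. by move=> os a; rewrite mem_rev => /os. Qed.

End Words.

(** * Every root is positive or negative *)

Section RootSystem.
Context {R : realType} {V : lmodType R}.
Variables (B : {symmetric V}) (Delta : set V).
Hypothesis rb : root_basis B Delta.
Implicit Types (a b u v x y : V) (s t : seq V).
Local Notation refl := (reflection B).
Local Notation wact := (word_act B).
Local Notation cone := (cone Delta).
Local Notation over := (word_over Delta).

Lemma basis_norm a : Delta a -> B a a = 1.
Proof. by case: rb => H _ _; exact: H. Qed.

Lemma basis_obtuse a b : Delta a -> Delta b -> a != b -> B a b <= 0.
Proof.
case: rb => _ H _ Da Db ab; have [[m m2 ->]|ab1] := H _ _ Da Db ab.
  by rewrite oppr_le0 cos_pi_div_ge0.
exact: le_trans ab1 (lerN10 _).
Qed.

(** A nonzero [u] would put the sum, which is 0, in [plc Delta], against (C2). *)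
Lemma cone_eq0 u v : cone u -> cone v -> u + v = 0 -> u = 0.
Proof.
case: rb => _ _ H /cone_plc[//|Pu] Cv uv0.
by case: H; rewrite -uv0; exact: plcDcone.
Qed.

Lemma cone_opp0 u : cone u -> cone (- u) -> u = 0.
Proof. by move=> Cu Cnu; apply: cone_eq0 Cu Cnu _; rewrite subrr. Qed.

Lemma wact_form s u v : over s -> B (wact s u) (wact s v) = B u v.
Proof.
elim: s => //= a s IH /over_cons[Da os].
by rewrite refl_form ?IH //; exact: basis_norm.
Qed.

Lemma wact_revK s v : over s -> wact (rev s) (wact s v) = v.
Proof.
elim: s => //= a s IH /over_cons[Da os].
by rewrite rev_cons wact_rcons reflK ?IH //; exact: basis_norm.
Qed.

Lemma wactK_rev s v : over s -> wact s (wact (rev s) v) = v.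
Proof. by move=> os; rewrite -{1}(revK s) wact_revK //; exact: over_rev. Qed.

Lemma wact_refl s x v : over s -> wact s (refl x v) = refl (wact s x) (wact s v).
Proof. by move=> os; rewrite {2}/reflection wact_form // linearB linearZ. Qed.

Definition reduced s := forall t, over t -> wact t =1 wact s -> (size s <= size t)%N.

Lemma reducedP s : over s ->
  exists t, [/\ over t, wact t =1 wact s, (size t <= size s)%N & reduced t].
Proof.
have [n] := ubnP (size s); elim: n s => // n IH s sn os.
have [rs|] := pselect (reduced s); first by exists s.
rewrite /reduced -existsNP => -[t].
move=> /not_implyP[ot] /not_implyP[ts] /negP; rewrite -ltnNge => lts.
have [||t' [ot' t't st' rt']] := IH t => //; first by lia.
by exists t'; split=> //; [move=> v; rewrite t't ts|lia].
Qed.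

Section Alternating.
Variables a b : V.
Hypotheses (Da : Delta a) (Db : Delta b).

(* The alternating word of length [k] in [a] and [b] whose last letter is [b];
   [letter k] is the one that extends it on the left. *)
Definition letter k := if odd k then a else b.

Fixpoint alt k := if k is k1.+1 then letter k1 :: alt k1 else [::].

Lemma letter_in k : Delta (letter k).
Proof. by rewrite /letter; case: odd. Qed.

Lemma letterSS k : letter k.+2 = letter k.
Proof. by rewrite /letter /= negbK. Qed.

Lemma over_alt k : over (alt k).
Proof.
by elim: k => //= k IH; apply/over_cons; split=> //; exact: letter_in.
Qed.

Lemma size_alt k : size (alt k) = k.
Proof. by elim: k => //= k ->. Qed.

Lemma form_letter k : B (letter k.+1) (letter k) = B a b.
Proof. by rewrite /letter /=; case: odd => //=; rewrite symformC. Qed.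

(** Reflecting in [letter k] keeps the other coefficient and replaces p_k by 2c p_(k+1) - p_k, the
    recursion of [dihedral_coef]. *)
Lemma wact_alt k : let c := - B a b in
  wact (alt k) a =
    dihedral_coef c k *: letter k + dihedral_coef c k.+1 *: letter k.+1.
Proof.
move=> c; elim: k => [|k IH]; first by rewrite /= scale0r add0r scale1r.
rewrite /= -/(wact _ _) IH letterSS linearD !linearZ_LR /=.
rewrite refl_self ?(basis_norm (letter_in k)) //.
rewrite /reflection form_letter scalerN scalerBr addrCA; congr (_ + _).
by rewrite scalerA -scaleNr -scaleNr -scalerDl; congr (_ *: _); rewrite /c; ring.
Qed.

(* At [k = m] the coefficients are [p_m = 0] and [p_(m-1) = 1]: the word of
   length [m - 1] maps [a] to the letter that extends it. *)
Lemma alt_shorten m k : (2 <= m)%N -> B a b = - cos (pi / m%:R) -> (m <= k)%N ->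
  exists t, [/\ over t, size t = k.-1 &
    wact t =1 wact (rcons (alt k) a)].
Proof.
move=> m2 Bab mk; elim: k mk => [|k IH]; first by lia.
rewrite leq_eqVlt => /predU1P[mE|mk]; last first.
  have [t [ot st tk]] := IH mk.
  exists (letter k :: t); split=> [||v]; last by rewrite /= -/(wact _ _) tk.
    by apply/over_cons; split => //; exact: letter_in.
  by rewrite /= st; lia.
exists (alt k); split; [exact: over_alt|by rewrite size_alt|move=> v].
rewrite wact_rcons /= -/(wact _ _) (wact_refl _ _ (@over_alt k)) wact_alt.
rewrite Bab opprK mE dihedral_coef_cosm -?mE // mE dihedral_coef_cosm1; last by lia.
rewrite scale0r addr0 scale1r reflK //; exact: basis_norm (letter_in k).
Qed.

End Alternating.

(** Induction on length. Split [s] as [v] times an alternating word in [a], [b] that cannot be made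
    longer: [v] sends both [a] and [b] into the cone by induction, and the alternating word sends
    [a] to a nonnegative combination of them. *)
Lemma reduced_cone n s a : size s = n -> over s -> Delta a -> reduced s ->
  (forall t, over t -> wact t =1 wact (rcons s a) -> (size s <= size t)%N) ->
  cone (wact s a).
Proof.
have [N] := ubnP n; elim: N n s a => // N IH n s a nN sn os Da rs sa.
have [s0|[s' [b sE]]] : s = [::] \/ exists s' b, s = rcons s' b.
- by case/lastP: s {sn os rs sa} => [|s' b]; [left|right; exists s', b].
- by rewrite s0 /=; exact: cone_gen.
have [Db os'] : Delta b /\ over s' by apply/over_rcons; rewrite -sE.
have ab : a != b.
  apply/negP => /eqP ab; have := sa s' os'; rewrite sE size_rcons ltnn => H.
  suff : false by []; apply: H => v.
  by rewrite !wact_rcons ab reflK //; exact: basis_norm.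
pose P k := exists v : seq V, [/\ over v, (size v + k = n)%N &
  wact (v ++ alt a b k) =1 wact s].
have P1 : P 1%N.
  exists s'; split=> //; first by rewrite -sn sE size_rcons addn1.
  by rewrite sE -cats1.
have [k [Pk k1 kmax]] : exists k, [/\ P k, (1 <= k)%N & ~ P k.+1].
  apply: contrapT => nex.
  have Pall k : P k.+1.
    elim: k => // k IHk; apply: contrapT => nP; apply: nex.
    by exists k.+1.
  by have [v []] := Pall n; lia.
have [v [ov vk vs]] := Pk.
have oalt j := @over_alt a b Da Db j.
have rv : reduced v.
  move=> t ot tv.
  suff : (size s <= size (t ++ alt a b k))%N by rewrite size_cat size_alt; lia.
  by apply: rs => [|u]; [exact/over_cat|rewrite wact_cat tv -wact_cat vs].
have lin j := @letter_in a b Da Db j.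
have v1 t : over t -> wact t =1 wact (rcons v (letter a b k)) ->
    (size v <= size t)%N.
  (* A shorter word for [v] times [letter k] would extend the alternating part, giving [P k.+1]. *)
  move=> ot tv; rewrite leqNgt; apply/negP => lt.
  have tsE : wact (t ++ alt a b k.+1) =1 wact s.
    move=> u; rewrite wact_cat tv wact_rcons /= -/(wact _ _).
    by rewrite reflK ?(basis_norm (lin k)) // -wact_cat vs.
  have : (size s <= size (t ++ alt a b k.+1))%N by apply: rs => //; exact/over_cat.
  rewrite size_cat size_alt => le.
  by apply: kmax; exists t; split=> //; lia.
have v2 t : over t -> wact t =1 wact (rcons v (letter a b k.+1)) ->
    (size v <= size t)%N.
  (* [letter k.+1] is the first letter of [alt a b k]; cancelling it would give a word shorter than
     [s]. *)
  move=> ot tv; rewrite leqNgt; apply/negP => lt.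
  have tsE : wact (t ++ alt a b k.-1) =1 wact s.
    move=> u; rewrite -vs !wact_cat tv wact_rcons; congr (wact v _).
    by case: (k) k1 => // j _; rewrite /= letterSS.
  have : (size s <= size (t ++ alt a b k.-1))%N by apply: rs => //; exact/over_cat.
  by rewrite size_cat size_alt; lia.
have C1 : cone (wact v (letter a b k)).
  by apply: (IH (size v)) => //; lia.
have C2 : cone (wact v (letter a b k.+1)).
  by apply: (IH (size v)) => //; lia.
suff [p1 p2] : 0 <= dihedral_coef (- B a b) k /\ 0 <= dihedral_coef (- B a b) k.+1.
  rewrite -vs wact_cat (wact_alt Da Db) linearD !linearZ_LR /=.
  by apply: coneD; exact: coneZ.
have [_ H _] := rb; have [[m m2 Bab]|Bab] := H _ _ Da Db ab; last first.
  by split; apply: dihedral_coef_ge0; lra.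
have [km|mk] := ltnP k m.
  by rewrite Bab opprK !dihedral_coef_cos_ge0 //; lia.
(* For k >= m the word [alt a b k] followed by [a] shortens, so [s] followed by [a] would be shorter
   than [s]. *)
have [t [ot st tE]] := alt_shorten Da Db m2 Bab mk.
have : (size s <= size (v ++ t))%N.
  apply: sa => [|u]; first exact/over_cat.
  by rewrite wact_cat tE !wact_rcons -vs wact_cat.
by rewrite size_cat st; lia.
Qed.

(** Take a shortest word s'. If appending [a] shortens it, [reduced_cone] applies to a shortest word
    for the product, which sends [a] to the opposite of s' a. *)
Lemma wact_dichotomy s a : over s -> Delta a ->
  cone (wact s a) \/ cone (- wact s a).
Proof.
move=> os Da; have [s' [os' s's _ rs']] := reducedP os.
rewrite -s's => {s s's os}.
have [sa|] := pselect
    (forall t, over t -> wact t =1 wact (rcons s' a) -> (size s' <= size t)%N).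
  by left; exact: reduced_cone rs' sa.
rewrite -existsNP => -[t].
move=> /not_implyP[ot] /not_implyP[ts] /negP; rewrite -ltnNge => lt.
have [t' [ot' t't st' rt']] := reducedP ot.
have t'E v : wact t' v = wact s' (refl a v) by rewrite t't ts wact_rcons.
right; have -> : - wact s' a = wact t' a.
  by rewrite t'E refl_self ?linearN //; exact: basis_norm.
apply: (reduced_cone (n := size t')) => // r or rE.
have := rs' r or; suff rs : wact r =1 wact s' by move=> /(_ rs); lia.
by move=> v; rewrite rE wact_rcons t'E reflK //; exact: basis_norm.
Qed.

End RootSystem.

(** * Exchange, inversions and lengths of reflections *)

Section PositiveRoots.
Context {R : realType} {V : lmodType R}.
Variables (B : {symmetric V}) (Delta : set V).
Hypothesis rb : root_basis B Delta.
Implicit Types (a b u v x y z : V) (s t : seq V).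
Local Notation refl := (reflection B).
Local Notation wact := (word_act B).
Local Notation cone := (cone Delta).
Local Notation over := (word_over Delta).

Definition is_root x : Prop := exists s a, [/\ over s, Delta a & x = wact s a].
Local Notation root := is_root.

Lemma basis_root a : Delta a -> root a.
Proof. by move=> Da; exists [::], a. Qed.

Lemma root_norm x : root x -> B x x = 1.
Proof. by move=> [s [a [os Da ->]]]; rewrite (wact_form rb) // (basis_norm rb). Qed.

Lemma root_neq0 x : root x -> x <> 0.
Proof.
move=> /root_norm + x0; rewrite x0 linear0l => /esym /eqP.
by rewrite oner_eq0.
Qed.

Lemma root_wact s x : over s -> root x -> root (wact s x).
Proof.
move=> os [t [a [ot Da ->]]]; exists (s ++ t), a; rewrite wact_cat.
by split=> //; exact/over_cat.
Qed.

Lemma root_refl a x : Delta a -> root x -> root (refl a x).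
Proof. by move=> Da; apply: (@root_wact [:: a]); exact/over_cons. Qed.

Lemma root_opp x : root x -> root (- x).
Proof.
move=> [s [a [os Da ->]]]; exists (rcons s a), a; split => //.
  exact/over_rcons.
by rewrite wact_rcons refl_self ?linearN // (basis_norm rb).
Qed.

Lemma root_dichotomy x : root x -> cone x \/ cone (- x).
Proof. by move=> [s [a [os Da ->]]]; exact: (wact_dichotomy rb). Qed.

Lemma root_cone_opp x : root x -> cone x -> ~ cone (- x).
Proof. by move=> /root_neq0 x0 Cx Cnx; apply/x0/(cone_opp0 rb). Qed.

Lemma root_refl_word x : root x -> exists2 s, over s & wact s =1 refl x.
Proof.
move=> [s [a [os Da ->]]]; exists (s ++ a :: rev s).
  by apply/over_cat; split => //; apply/over_cons; split => //; exact: over_rev.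
by move=> v; rewrite wact_cat /= -/(wact _ _) (wact_refl rb) // (wactK_rev rb).
Qed.

(** Here [v'] collects the generators other than [a], all obtuse to [a]. This replaces coefficients,
    which are not unique when [Delta] is dependent. *)
Lemma cone_split a v : Delta a -> cone v ->
  exists k v', [/\ 0 <= k, cone v', B v' a <= 0 & v = k *: a + v'].
Proof.
move=> Da; elim=> [|b l w Db l0 _ [k [w' [k0 Cw' w'a ->]]]].
  exists 0, 0; rewrite linear0l scale0r addr0; split => //; exact: cone0.
have [->|ba] := eqVneq b a.
  by exists (l + k), w'; rewrite addr_ge0 // scalerDl addrA.
exists k, (l *: b + w'); split => //; last by rewrite addrCA.
  exact: cone_cons.
by rewrite linearPl /=; have := basis_obtuse rb Db Da ba; nra.
Qed.

(** Split off the multiples of [a]. Pairing the rest with [a] shows that it sums to a nonpositive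
    multiple of [a], hence vanishes by (C2). *)
Lemma simple_face a u v (k : R) : Delta a -> cone u -> cone v ->
  u + v = k *: a -> exists j, u = j *: a.
Proof.
move=> Da Cu Cv; have [j [u' [j0 Cu' u'a ->]]] := cone_split Da Cu.
have [l [v' [l0 Cv' v'a ->]]] := cone_split Da Cv.
rewrite addrACA -scalerDl => E.
have E' : u' + v' = (k - (j + l)) *: a by rewrite scalerBl -E [RHS]addrC addKr.
have le0 : k - (j + l) <= 0.
  have -> : k - (j + l) = B u' a + B v' a.
    by rewrite -symformDl E' symformZl (basis_norm rb) // mulr1.
  by rewrite -oppr_ge0 opprD addr_ge0 // oppr_ge0.
exists j; suff -> : u' = 0 by rewrite addr0.
apply: (cone_eq0 rb Cu' (coneD Cv' (coneZ (k := - (k - (j + l))) _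
  (cone_gen Da)))).
  by rewrite oppr_ge0.
by rewrite addrA E' scaleNr subrr.
Qed.

Lemma colinear_roots x y (k : R) : root x -> root y -> cone x -> cone y ->
  x = k *: y -> x = y.
Proof.
move=> rx ry Cx Cy xE; have := root_norm rx.
rewrite xE symformZl symformZr (root_norm ry) mulr1 => kk.
have /orP[/eqP ->|/eqP k1] : (k == 1) || (k == -1).
  by rewrite -sqrf_eq1 expr2 kk.
- by rewrite scale1r.
- case: (root_cone_opp rx Cx); rewrite xE k1 scaleN1r opprK //.
Qed.

Lemma simple_face_root a x v (k : R) : Delta a -> root x -> cone x -> cone v ->
  x + v = k *: a -> x = a.
Proof.
move=> Da rx Cx Cv /(simple_face Da Cx Cv)[j].
apply: colinear_roots => //; [exact: basis_root|exact: cone_gen].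
Qed.

(** If the image were negative, [x] plus its opposite would be a multiple of [a], forcing x = a. *)
Lemma simple_refl_pos a x : Delta a -> root x -> cone x -> x <> a ->
  cone (refl a x).
Proof.
move=> Da rx Cx xa; have [//|Cn] := root_dichotomy (root_refl Da rx).
case: xa; apply: (simple_face_root Da rx Cx Cn (k := 2 * B x a)).
by rewrite /reflection opprB addrC subrK.
Qed.

(** The sign changes at some letter [b], and the reflection in [b] makes no positive root but [b]
    negative. *)
Lemma exchange s x : over s -> root x -> cone x -> cone (- wact s x) ->
  exists s1 b s2, s = s1 ++ b :: s2 /\ wact s2 x = b.
Proof.
move=> os rx Cx; elim: s os => [|b s IH] /=.
  by move=> _ /(root_cone_opp rx Cx).
move=> /over_cons[Db os]; rewrite -/(wact _ _) => Cn.
have rs := root_wact os rx; have rbs := root_refl Db rs.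
have [Cs|Cns] := root_dichotomy rs; last first.
  have [s1 [c [s2 [-> E]]]] := IH os Cns.
  by exists (b :: s1), c, s2.
exists [::], b, s; split=> //; apply: contrapT => sxb.
exact: (root_cone_opp rbs (simple_refl_pos Db rs Cs sxb)).
Qed.

(** Each splitting s1 b s2 contributes s2^-1 b. If [s] is not reduced, some entries may fail to be
    inversions; the list only bounds them. *)
Fixpoint inversions s : seq V :=
  if s is b :: t then wact (rev t) b :: inversions t else [::].

Lemma inversionsP s x : over s -> root x -> cone x -> cone (- wact s x) ->
  x \in inversions s.
Proof.
move=> os rx Cx /(exchange os rx Cx)[s1 [b [s2 [sE bE]]]].
have [_ os2] : Delta b /\ over s2.
  by apply/over_cons; move: os; rewrite sE over_cat => -[].
rewrite {}sE {os}; elim: s1 => [|c s1 IH] /=; last by rewrite inE IH orbT.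
by rewrite -bE (wact_revK rb) // mem_head.
Qed.

(** With s = s1 b s2 and s2 a = b, conjugation turns the appended [a] into a second [b], and the two
    cancel. *)
Lemma shorten s a : over s -> Delta a -> cone (- wact s a) ->
  exists t, [/\ over t, (size t).+1 = size s & wact t =1 wact (rcons s a)].
Proof.
move=> os Da /(exchange os (basis_root Da) (cone_gen Da))[s1 [b [s2 [sE bE]]]].
move: os; rewrite sE => /over_cat[os1 /over_cons[Db os2]].
exists (s1 ++ s2); split=> [||v]; first exact/over_cat.
  by rewrite !size_cat /= addnS.
rewrite wact_rcons !wact_cat /= -/(wact _ _) (wact_refl rb a v os2) bE.
by rewrite reflK // (basis_norm rb).
Qed.

Definition refl_length_le n x :=
  exists s, [/\ over s, (size s <= n)%N & wact s =1 refl x].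

Lemma refl_conj a x v : Delta a -> refl (refl a x) v = refl a (refl x (refl a v)).
Proof.
move=> Da; have oa : over [:: a] by apply/over_cons.
have := wact_refl rb x (refl a v) oa => /= ->.
by rewrite reflK // (basis_norm rb).
Qed.

Lemma refl_length_up n a x : Delta a -> refl_length_le n x ->
  refl_length_le n.+2 (refl a x).
Proof.
move=> Da [s [os sn sE]]; exists (a :: rcons s a); split.
- by apply/over_cons; split=> //; apply/over_rcons.
- by rewrite /= size_rcons.
- by move=> v; rewrite wact_cons wact_rcons sE refl_conj.
Qed.

(** Both r_x and the inverse of r_x r_a send [a] to a negative root, so appending [a] deletes a
    letter twice. *)
Lemma refl_length_down n a x : Delta a -> root x -> cone x -> x <> a ->
  0 < B x a -> refl_length_le n x ->
  exists2 m, (m.+2 <= n)%N & refl_length_le m (refl a x).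
Proof.
move=> Da rx Cx xa xa0 [s [os sn sE]].
have reflE : refl x a = a - (2 * B x a) *: x by rewrite /reflection (symformC _ a).
have k0 : 0 <= 2 * B x a by rewrite mulr_ge0 // ltW.
have rxa : root (refl x a) by rewrite -sE; apply: root_wact => //; exact: basis_root.
have Cn : cone (- refl x a).
  (* Were r_x a positive, a = r_x a + 2(x, a) x would force x = a. *)
  have [Cp|//] := root_dichotomy rxa; case: xa.
  apply: (simple_face_root Da rx Cx (v := (2 * B x a)^-1 *: refl x a)
    (k := (2 * B x a)^-1)).
    by apply: coneZ => //; rewrite invr_ge0.
  rewrite reflE scalerBr scalerA mulVf ?scale1r; last by apply/lt0r_neq0; lra.
  by rewrite addrC subrK.
have [t [ot ts tE]] : exists t, [/\ over t, (size t).+1 = size s &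
    wact t =1 wact (rcons s a)] by apply: shorten => //; rewrite sE.
have tE' v : wact (rev t) v = refl a (refl x v).
  rewrite -[RHS](wact_revK rb _ ot) tE wact_rcons sE.
  by rewrite !reflK // ?(root_norm rx) // (basis_norm rb).
have Cn' : cone (- wact (rev t) a).
  rewrite tE' -linearN; apply: simple_refl_pos => //; first exact: root_opp.
  (* If r_x a = -a, then x is proportional to [a]. *)
  move=> E; apply: xa; apply: (simple_face_root Da rx Cx (v := 0) (k := (B x a)^-1)).
    exact: cone0.
  have : (2 * B x a) *: x = a *+ 2.
    by rewrite mulr2n -[X in _ = a + X]E reflE opprB addrC subrK.
  have two : (2 : R) != 0 by rewrite pnatr_eq0.
  rewrite addr0 => x2E; have xE : B x a *: x = a.
    by apply: (scalerI two); rewrite scalerA x2E scaler_nat.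
  rewrite -[X in _ = _ *: X]xE scalerA mulVf ?scale1r //.
  exact: lt0r_neq0.
have [r [or rs rE]] := shorten (over_rev ot) Da Cn'.
exists (size s).-2; first by move: rs; rewrite size_rev; lia.
exists r; split=> //; first by move: rs; rewrite size_rev; lia.
by move=> v; rewrite rE wact_rcons tE' refl_conj.
Qed.

Lemma refl_inj x y : root x -> root y -> cone x -> cone y ->
  refl x =1 refl y -> x = y.
Proof.
move=> rx ry Cx Cy /(_ x); rewrite refl_self ?root_norm // /reflection => E.
apply: (colinear_roots (k := B x y)) => //.
have two : (2 : R) != 0 by rewrite pnatr_eq0.
apply: (scalerI two).
rewrite scalerA scaler_nat mulr2n.
by rewrite -{1}[x]opprK E opprB subrK.
Qed.

End PositiveRoots.

(** * Dominance and the Tits cone *)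

Section TitsConeSegment.
Context {R : realType} {V : lmodType R}.
Variables (B : {symmetric V}) (Delta : set V).
Hypothesis rb : root_basis B Delta.
Implicit Types (a b u v x y z : V) (s t L : seq V) (F : V -> R).
Local Notation refl := (reflection B).
Local Notation wact := (word_act B).
Local Notation cone := (cone Delta).
Local Notation over := (word_over Delta).
Local Notation root := (is_root B Delta).
Local Notation span := (lin_span Delta).

(** Functionals on X are carried by functions on [V], whose values off the span are arbitrary. *)
Definition linear_on_span F : Prop :=
  forall (k : R) u v, span u -> span v -> F (k *: u + v) = k * F u + F v.

Section LinearOnSpan.
Variable F : V -> R.
Hypothesis FL : linear_on_span F.

Lemma linear_on_span0 : F 0 = 0.
Proof.
have := FL 1 (lin_span0 Delta) (lin_span0 Delta).
by rewrite scale1r addr0 mul1r => /eqP; rewrite -subr_eq0 opprD addNKr oppr_eq0 => /eqP.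
Qed.

Lemma linear_on_spanZ (k : R) u : span u -> F (k *: u) = k * F u.
Proof.
by move=> Su; rewrite -[k *: u]addr0 FL ?linear_on_span0 ?addr0 //; exact: lin_span0.
Qed.

Lemma linear_on_spanN u : span u -> F (- u) = - F u.
Proof. by move=> Su; rewrite -scaleN1r linear_on_spanZ // mulN1r. Qed.

Lemma basis_in_span a : Delta a -> span a.
Proof. by move=> Da; apply/cone_span/cone_gen. Qed.

Lemma span_refl a v : Delta a -> span v -> span (refl a v).
Proof.
move=> Da Sv; rewrite /reflection -scaleNr.
by apply: lin_spanD => //; exact: lin_span_gen.
Qed.

Lemma span_wact s v : over s -> span v -> span (wact s v).
Proof.
elim: s => //= a s IH /over_cons[Da os] Sv.
by apply: span_refl => //; exact: IH.
Qed.

Lemma root_in_span x : root x -> span x.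
Proof. by move=> [s [a [os Da ->]]]; apply/span_wact/basis_in_span. Qed.

Lemma linear_on_span_wact s : over s -> linear_on_span (F \o wact s).
Proof. by move=> os k u v Su Sv; rewrite /= linearP FL //; exact: span_wact. Qed.

Lemma linear_on_span_refl x v : span x -> span v ->
  F (refl x v) = F v - 2 * B v x * F x.
Proof.
by move=> Sx Sv; rewrite /reflection -scaleNr addrC FL // mulNr addrC.
Qed.

Lemma linear_on_span_cone v : (forall a, Delta a -> 0 <= F a) -> cone v -> 0 <= F v.
Proof.
move=> F0; elim=> [|a k w Da k0 Cw IH]; first by rewrite linear_on_span0.
rewrite FL; [|exact: basis_in_span|exact: cone_span].
by rewrite addr_ge0 // mulr_ge0 // F0.
Qed.

End LinearOnSpan.

(* Reflecting in a simple root on which [F] is negative removes exactly one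
   positive root from the set where [F] is negative. *)
Lemma in_tits_cone F L : linear_on_span F ->
  (forall z, root z -> cone z -> F z < 0 -> z \in L) ->
  exists2 s, over s & forall a, Delta a -> 0 <= F (wact s a).
Proof.
have [n] := ubnP (size L); elim: n F L => // n IH F L Ln FL FP.
have [F0|] := pselect (forall a, Delta a -> 0 <= F a); first by exists [::].
rewrite -existsNP => -[a /not_implyP[Da /negP]]; rewrite -ltNge => Fa.
have aa := basis_norm rb Da.
have oa : over [:: a] by apply/over_cons.
have La : a \in L by apply: FP => //; [exact: basis_root|exact: cone_gen].
case: (IH (F \o refl a) [seq refl a z | z <- L & z != a]).
- rewrite size_map size_filter.
  have La0 : (0 < count_mem a L)%N by rewrite -has_count has_pred1.
  rewrite (eq_count (a2 := predC (pred1 a))) //.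
  move: Ln; rewrite ltnS -(count_predC (pred1 a)); apply: leq_trans.
  by rewrite -[X in (X < _)%N]add0n ltn_add2r.
- exact: (linear_on_span_wact FL oa).
- move=> z rz Cz /= Fz; rewrite -[z](reflK aa); apply: map_f.
  rewrite mem_filter; apply/andP; split.
    apply/negP => /eqP E; case: (root_cone_opp rb rz Cz).
    have -> : - z = a by rewrite -[z](reflK aa) E refl_self // opprK.
    exact: cone_gen.
  apply: FP => //; first exact: root_refl.
  apply: simple_refl_pos => // za; move: Fz.
  rewrite za refl_self // linear_on_spanN; [lra|exact: FL|exact: basis_in_span].
- by move=> s os sP; exists (a :: s) => //; apply/over_cons.
Qed.

Definition word_dominates x y : Prop :=
  forall s, over s -> cone (- wact s x) -> cone (- wact s y).
Local Notation dom := word_dominates.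

Lemma dom_wact s x y : over s -> dom x y -> dom (wact s x) (wact s y).
Proof.
move=> os xy t ot; rewrite -!wact_cat; apply: xy; exact/over_cat.
Qed.

Lemma dom_opp x y : root x -> root y -> dom x y -> dom (- y) (- x).
Proof.
move=> rx ry xy s os; rewrite !linearN !opprK => Cy.
have [//|/(xy s os)] := root_dichotomy rb (root_wact os rx).
by move=> /(root_cone_opp rb (root_wact os ry) Cy).
Qed.

(* Alternately reflecting in x and y turns the pair into (z_(k+1), z_k) or its
   opposite, where z_(k+1) = p_(k+1) x - p_k y; dominance makes every z_k
   positive, which is impossible once p changes sign. *)
Lemma dom_form_pos x y : root x -> root y -> cone y -> dom x y -> 1 <= B x y.
Proof.
move=> rx ry Cy xy; rewrite leNgt; apply/negP => c1.
set c := B x y in c1.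
(* The value [y] at 0 fits the formula with p_(-1) = -1, so the recursion starts there. *)
pose z k := if k is k1.+1 then dihedral_coef c k *: x - dihedral_coef c k1 *: y
  else y.
have zSS k : z k.+2 = (2 * c) *: z k.+1 - z k.
  case: k => [|k]; rewrite /z.
    by rewrite /= scale0r subr0 scale1r mulr1 subr0 scale1r.
  suff E (p0 p1 p2 p3 : R) : p2 = 2 * c * p1 - p0 -> p3 = 2 * c * p2 - p1 ->
      p3 *: x - p2 *: y = (2 * c) *: (p2 *: x - p1 *: y) - (p1 *: x - p0 *: y).
    by apply: E; exact: dihedral_coefSS.
  move=> e2 ->; rewrite [X in _ - X *: y = _]e2 scalerBr !scalerBl !scalerA !opprB.
  by rewrite addrACA [RHS]addrACA; congr (_ + _); exact: addrC.
have z0 : z 0%N = y by [].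
have zS k : z k.+1 = dihedral_coef c k.+1 *: x - dihedral_coef c k *: y by [].
have z1 : z 1%N = x by rewrite zS /= scale0r subr0 scale1r.
clearbody z.
have [sx osx sxE] := root_refl_word rb rx; have [sy osy syE] := root_refl_word rb ry.
have xx := root_norm rb rx; have yy := root_norm rb ry.
have Q k : exists2 s, over s & (wact s x = z k.+1 /\ wact s y = z k) \/
    (wact s x = - z k /\ wact s y = - z k.+1).
  elim: k => [|k [s os [[xE yE]|[xE yE]]]].
  - by exists [::] => //; left; rewrite z0 z1.
  - exists (s ++ sx); first exact/over_cat.
    right; rewrite !wact_cat !sxE refl_self // linearN /= xE; split=> //.
    rewrite /reflection linearB linearZ_LR /= xE yE symformC zSS.
    by rewrite opprB.
  - exists (s ++ sy); first exact/over_cat.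
    left; rewrite !wact_cat !syE refl_self // linearN /= yE opprK; split=> //.
    rewrite /reflection linearB linearZ_LR /= xE yE zSS.
    by rewrite scalerN opprK addrC.
have Cz k : cone (z k).
  elim: k => [|k IH]; [by rewrite z0|have [s os [[xE yE]|[xE yE]]] := Q k].
    have := root_dichotomy rb (root_wact os rx); rewrite xE => -[//|].
    rewrite -xE => /(xy s os); rewrite yE => Cn.
    by have := root_wact os ry; rewrite yE => /(root_cone_opp rb)/(_ IH).
  by have := xy s os; rewrite xE yE !opprK; apply.
have [k [p0 p1]] := dihedral_coef_neg c1.
have Cx : cone x by rewrite -z1.
(* The vectors p_(k+1) y, z_(k+2) and -p_(k+2) x lie in the cone and sum to 0. *)
have : dihedral_coef c k.+1 *: y = 0.
  apply: (cone_eq0 rb) (coneZ (ltW p0) Cy)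
    (coneD (Cz k.+2) (coneZ (k := - dihedral_coef c k.+2) _ Cx)) _.
    by rewrite oppr_ge0.
  by rewrite zS scaleNr addrAC subrr add0r addrC addNr.
move=> /eqP; rewrite scaler_eq0 (gt_eqF p0) /= => /eqP.
exact: root_neq0 rb _ ry.
Qed.

Lemma dom_form x y : root x -> root y -> dom x y -> 1 <= B x y.
Proof.
move=> rx ry xy; have [s [a [os Da yE]]] := ry.
have os' := over_rev os; rewrite -(wact_form rb x y os').
have -> : wact (rev s) y = a by rewrite yE (wact_revK rb).
apply: dom_form_pos; [exact: root_wact|exact: basis_root|exact: cone_gen|].
by have := dom_wact os' xy; rewrite yE (wact_revK rb).
Qed.

(* If [F x < F y] with [0 < F y], then some [F - t F(y) B(., y)] with
   [0 <= t < 1] is negative at x and positive at y; it lies on the segment from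
   [F] to [F \o refl y], hence in the Tits cone, contradicting dominance. *)
Lemma dom_le_gt0 F x y : linear_on_span F -> (forall a, Delta a -> 0 <= F a) ->
  root x -> root y -> dom x y -> 0 < F y -> F y <= F x.
Proof.
move=> FL F0 rx ry xy Fy; rewrite leNgt; apply/negP => Fxy.
have c1 := dom_form rx ry xy.
have [t [t0 t1 tF]] : exists t : R, [/\ 0 <= t, t < 1 & F x < t * F y].
  have [Fx|Fx] := ltP (F x) 0; first by exists 0; rewrite mul0r; split; lra.
  (* The midpoint of F x / F y and 1. *)
  exists ((F x / F y + 1) / 2).
  have q0 : 0 <= F x / F y by rewrite divr_ge0 // ltW.
  have q1 : F x / F y < 1 by rewrite ltr_pdivrMr ?mul1r.
  split; [lra|lra|].
  rewrite mulrAC mulrDl divfK ?gt_eqF //; lra.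
pose G v := F v - t * F y * B v y.
have GL : linear_on_span G.
  by move=> k u v Su Sv; rewrite /G FL // linearPl /=; ring.
have [sy osy syE] := root_refl_word rb ry.
(* G is (1 - t/2) F + (t/2) F r_y, so G z < 0 with [z] positive forces r_y z to be negative. *)
have [z rz Cz Gz|s os sP] := in_tits_cone (L := inversions B sy) GL.
  apply: (inversionsP rb) => //; rewrite syE.
  have rrz : root (refl y z) by rewrite -syE; exact: root_wact.
  have [Cr|//] := root_dichotomy rb rrz.
  have := linear_on_span_cone FL F0 Cr; have := linear_on_span_cone FL F0 Cz.
  rewrite (linear_on_span_refl FL (root_in_span ry) (root_in_span rz)).
  by move: Gz; rewrite /G; nra.
have GsL := linear_on_span_wact GL os.
have os' := over_rev os.
have GE v : G v = (G \o wact s) (wact (rev s) v) by rewrite /= (wactK_rev rb).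
have Gy : 0 < G y by rewrite /G (root_norm rb ry); nra.
have Gx : G x < 0.
  rewrite /G subr_lt0; apply: lt_le_trans tF _.
  by rewrite ler_peMr // mulr_ge0 // ltW.
have rx' := root_wact os' rx; have ry' := root_wact os' ry.
have [Cx|/(xy _ os') Cy] := root_dichotomy rb rx'.
  by have := linear_on_span_cone GsL sP Cx; rewrite -GE; lra.
have := linear_on_span_cone GsL sP Cy.
rewrite (linear_on_spanN GsL (root_in_span ry')) -GE; lra.
Qed.

Lemma dom_le F x y : linear_on_span F -> (forall a, Delta a -> 0 <= F a) ->
  root x -> root y -> dom x y -> F y <= F x.
Proof.
move=> FL F0 rx ry xy; have [Fy|Fy] := ltP 0 (F y); first exact: dom_le_gt0.
have [Fx|Fx] := leP 0 (F x); first exact: le_trans Fx.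
have := dom_le_gt0 FL F0 (root_opp rb ry) (root_opp rb rx) (dom_opp rx ry xy).
rewrite !linear_on_spanN //; [lra|exact: root_in_span..].
Qed.

End TitsConeSegment.

(** * Descent to an antidominant vector *)

Section ShortWords.
Context {T : eqType}.
Implicit Types l s : seq T.

Fixpoint short_words l n : seq (seq T) :=
  [::] :: if n is n1.+1 then [seq a :: w | a <- l, w <- short_words l n1] else [::].

Lemma short_wordsP l n s : {subset s <= l} -> (size s <= n)%N -> s \in short_words l n.
Proof.
elim: n s => [|n IH] [|a s] //= sl; rewrite ltnS => sn; rewrite inE /=.
apply/allpairsP; exists (a, s); split=> //=; first by apply: sl; rewrite mem_head.
by apply: IH => // b bs; apply: sl; rewrite inE bs orbT.
Qed.

End ShortWords.

(** * Descent with finitely many simple roots *)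

Section FiniteRank.
Context {R : realType} {V : lmodType R}.
Variables (B : {symmetric V}) (Delta : set V).
Hypothesis rb : root_basis B Delta.
Variable l : seq V.
Hypothesis Dl : forall a, Delta a -> a \in l.
Implicit Types (a b u v x y z : V) (s t T : seq V).
Local Notation refl := (reflection B).
Local Notation wact := (word_act B).
Local Notation cone := (cone Delta).
Local Notation over := (word_over Delta).
Local Notation root := (is_root B Delta).
Local Notation length_le := (refl_length_le B Delta).

Lemma finite_short_roots n :
  exists T, forall x, root x -> cone x -> length_le n x -> x \in T.
Proof.
pose P w := [set x | [/\ root x, cone x & refl x =1 wact w]].
(* One root is chosen per word, with default 0 when the word is not a reflection; [refl_inj] makes
   the choice the right one. *)
exists [seq xget 0 (P w) | w <- short_words l n] => x rx Cx [s [os sn sE]].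
have Px : P s x by split=> // v; rewrite sE.
have [rx' Cx' xE] : P s (xget 0 (P s)) by apply: xgetPex; exists x.
have -> : x = xget 0 (P s).
  by apply: (refl_inj rb) => // v; rewrite xE sE.
by apply/map_f/short_wordsP => // a /os /Dl.
Qed.

Definition pair_length_le N x z : Prop :=
  exists p q, [/\ (p + q <= N)%N, length_le p x & length_le q z].

(** At least one of (x, a), (z, a) is positive, so one length drops by 2 while the other rises by at
    most 2. *)
Lemma pair_length_refl N a x z : Delta a ->
  root x -> cone x -> x <> a -> root z -> cone z -> z <> a -> 0 < B (x + z) a ->
  pair_length_le N x z -> pair_length_le N (refl a x) (refl a z).
Proof.
move=> Da rx Cx xa rz Cz za; rewrite symformDl => pos [p [q [pq px qz]]].
have [xa0|xa0|xa0] := ltrgtP (B x a) 0.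
- have za0 : 0 < B z a by lra.
  have [m mq mz] := refl_length_down rb Da rz Cz za za0 qz.
  exists p.+2, m; split=> //; [by lia|exact: refl_length_up].
- have [m mp mx] := refl_length_down rb Da rx Cx xa xa0 px.
  have [za0|za0|za0] := ltrgtP (B z a) 0.
  + exists m, q.+2; split=> //; [by lia|exact: refl_length_up].
  + have [m' mq mz] := refl_length_down rb Da rz Cz za za0 qz.
    by exists m, m'; split=> //; lia.
  + by exists m, q; rewrite (@refl_eq0 _ _ _ a z) //; split=> //; lia.
- have za0 : 0 < B z a by lra.
  have [m mq mz] := refl_length_down rb Da rz Cz za za0 qz.
  by exists p, m; rewrite (@refl_eq0 _ _ _ a x) //; split=> //; lia.
Qed.

(* Reflecting in a simple root [a] with [(x + z, a) > 0] strictly lowers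
   [x + z] in the order of the cone and does not raise the total length of the
   reflections in [x] and [z]; only finitely many pairs are available. *)
Lemma antidominant_descent N T x z : root x -> cone x -> root z -> cone z ->
  B x z <= -1 -> pair_length_le N x z ->
  (forall x' z', root x' -> cone x' -> root z' -> cone z' ->
    pair_length_le N x' z' -> cone (x + z - (x' + z')) -> x' + z' \in T) ->
  exists s, [/\ over s, cone (wact s x), cone (wact s z) &
    forall a, Delta a -> B (wact s (x + z)) a <= 0].
Proof.
have [n] := ubnP (size T); elim: n T x z => // n IH T x z Tn.
move=> rx Cx rz Cz xz1 len TP.
have [le0|] := pselect (forall a, Delta a -> B (x + z) a <= 0).
  by exists [::].
rewrite -existsNP => -[a /not_implyP[Da /negP]]; rewrite -ltNge => pos.
have aa := basis_norm rb Da.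
(* (x + z, x) = 1 + (x, z) <= 0, and likewise for [z]. *)
have xa : x <> a.
  by move=> xa; move: pos; rewrite symformDl -xa (root_norm rb rx) symformC; lra.
have za : z <> a.
  by move=> za; move: pos; rewrite symformDl -za (root_norm rb rz); lra.
set k := 2 * B (x + z) a.
have k0 : 0 < k by rewrite /k; lra.
have sumE : refl a x + refl a z = x + z - k *: a by rewrite -linearD.
case: (IH [seq t <- T | t != x + z] (refl a x) (refl a z)).
- have xzT : x + z \in T.
    by apply: TP => //; rewrite subrr; exact: cone0.
  have xz0 : (0 < count_mem (x + z)%R T)%N by rewrite -has_count has_pred1.
  rewrite size_filter (eq_count (a2 := predC (pred1 (x + z)))) //.
  move: Tn; rewrite ltnS -(count_predC (pred1 (x + z))); apply: leq_trans.
  by rewrite -[X in (X < _)%N]add0n ltn_add2r.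
- exact: root_refl.
- exact: (simple_refl_pos rb).
- exact: root_refl.
- exact: (simple_refl_pos rb).
- by rewrite refl_form.
- exact: pair_length_refl.
- move=> x' z' rx' Cx' rz' Cz' len' C; rewrite mem_filter.
  have Ck : cone (k *: a) by apply: coneZ; [exact: ltW|exact: cone_gen].
  rewrite sumE in C; apply/andP; split; last first.
    apply: TP => //; suff -> : x + z - (x' + z') = x + z - k *: a - (x' + z') + k *: a.
      exact: coneD.
    by rewrite [RHS]addrAC subrK.
  (* Returning to the sum x + z would put -k a in the cone. *)
  apply/negP => /eqP E; move: C; rewrite E addrAC subrr add0r => Cn.
  have := cone_opp0 rb Ck Cn => /eqP; rewrite scaler_eq0 (gt_eqF k0) /= => /eqP.
  exact: root_neq0 rb _ (basis_root B Da).
- move=> s [os Csx Csz sle]; exists (rcons s a); rewrite !wact_rcons.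
  split=> //; first exact/over_rcons.
  by move=> b Db; have := sle b Db; rewrite -linearD.
Qed.

Lemma finite_rank_antidominant x z : root x -> cone x -> root z -> cone z ->
  B x z <= -1 ->
  exists s, [/\ over s, cone (wact s x), cone (wact s z) &
    forall a, Delta a -> B (wact s (x + z)) a <= 0].
Proof.
move=> rx Cx rz Cz xz1.
have [sx osx sxE] := root_refl_word rb rx; have [sz osz szE] := root_refl_word rb rz.
pose N := (size sx + size sz)%N.
have [T TP] := finite_short_roots N.
apply: (antidominant_descent (N := N) (T := [seq u + v | u <- T, v <- T])) => //.
  by exists (size sx), (size sz); split=> //; [exists sx|exists sz].
move=> x' z' rx' Cx' rz' Cz' [p [q [pq [sp [osp ssp spE]] [sq [osq ssq sqE]]]]] _.
apply/allpairsP; exists (x', z'); split=> //=; apply: TP => //.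
  by exists sp; split=> //; lia.
by exists sq; split=> //; lia.
Qed.

End FiniteRank.

(** * Reduction to a finite set of simple roots *)

Section Antidominant.
Context {R : realType} {V : lmodType R}.
Variables (B : {symmetric V}) (Delta : set V).
Hypothesis rb : root_basis B Delta.
Implicit Types (a b u v x y z : V) (s t l : seq V).
Local Notation refl := (reflection B).
Local Notation wact := (word_act B).
Local Notation over := (word_over Delta).
Local Notation root := (is_root B Delta).

Lemma root_basis_sub (Delta' : set V) : Delta' `<=` Delta -> root_basis B Delta'.
Proof.
case: rb => h1 h2 h3 sub; split=> [a /sub /h1 //|a b /sub Da /sub Db|].
  exact: h2.
move=> [s [c [us sD c0 cpos E]]]; apply: h3; exists s, c; split=> //.
by move=> a /sD /sub.
Qed.

(** Allowing any larger list lets the supports of two roots be merged. *)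
Lemma root_finite_support x : root x -> exists2 l, over l &
  forall l', {subset l <= l'} -> is_root B [set` l'] x.
Proof.
move=> [s [a [os Da ->]]]; exists (a :: s); first exact/over_cons.
move=> l' sub; exists s, a; split=> //.
  by move=> b bs /=; apply: sub; rewrite inE bs orbT.
by apply: sub; rewrite mem_head.
Qed.

Lemma root_cone_sub (Delta' : set V) x : Delta' `<=` Delta ->
  is_root B Delta' x -> cone Delta x -> cone Delta' x.
Proof.
move=> sub rx Cx; have rb' := root_basis_sub sub.
have [//|/(cone_sub sub) Cn] := root_dichotomy rb' rx.
by case: (root_neq0 rb' rx); exact: (cone_opp0 rb).
Qed.

Lemma cone_obtuse (Delta' : set V) v a : Delta' `<=` Delta -> cone Delta' v ->
  Delta a -> ~ Delta' a -> B v a <= 0.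
Proof.
move=> sub Cv Da nDa; elim: Cv => [|b k w Db k0 _ IH]; first by rewrite linear0l.
have ba : b != a by apply/negP => /eqP ba; apply: nDa; rewrite -ba.
by rewrite linearPl /=; have := basis_obtuse rb (sub _ Db) Da ba; nra.
Qed.

(** The descent runs over the joint support; every other simple root is obtuse to the cone of that
    support. *)
Lemma antidominant x z : root x -> cone Delta x -> root z -> cone Delta z ->
  B x z <= -1 ->
  exists2 s, over s & forall v, cone Delta v -> B (wact s (x + z)) v <= 0.
Proof.
move=> rx Cx rz Cz xz1.
have [lx olx lxP] := root_finite_support rx.
have [lz olz lzP] := root_finite_support rz.
pose l := lx ++ lz; pose I : set V := [set` l].
have sub : I `<=` Delta by move=> a; rewrite /I /l /= mem_cat => /orP[/olx|/olz].
have rbI := root_basis_sub sub.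
have rxI : is_root B I x by apply: lxP => a al; rewrite /l mem_cat al.
have rzI : is_root B I z by apply: lzP => a al; rewrite /l mem_cat al orbT.
have [s [os Csx Csz sle]] := finite_rank_antidominant rbI (l := l) (fun=> id)
  rxI (root_cone_sub sub rxI Cx) rzI (root_cone_sub sub rzI Cz) xz1.
exists s; first by move=> a /os /sub.
move=> v; elim=> [|a k w Da k0 _ IH]; first by rewrite linear0r.
suff : B (wact s (x + z)) a <= 0 by rewrite linearPr /=; nra.
have [Ia|nIa] := pselect (I a); first exact: sle.
by rewrite linearD symformDl /=; have := cone_obtuse sub Csx Da nIa;
  have := cone_obtuse sub Csz Da nIa; lra.
Qed.

Lemma dom_form_finite x y : root x -> root y -> word_dominates B Delta x y ->
  exists L : seq V, forall a, root a -> cone Delta a -> 0 < B (x - y) a -> a \in L.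
Proof.
move=> rx ry xy; have [xyE|/eqP xyN] := eqVneq x y.
  by exists [::] => a _ _; rewrite xyE subrr linear0l ltxx.
have [s [a [os Da yE]]] := ry.
have os' := over_rev os; set x' := wact (rev s) x.
have yE' : wact (rev s) y = a by rewrite yE (wact_revK rb).
have rx' : root x' by exact: root_wact.
have ra : root a by exact: basis_root.
have xa : x' <> a.
  by rewrite -yE' => E; apply: xyN; rewrite -[LHS](wactK_rev rb _ os) -/x' E (wactK_rev rb).
have Cx' : cone Delta x'.
  have [//|/(xy _ os')] := root_dichotomy rb rx'.
  by rewrite yE' => /(root_cone_opp rb ra (cone_gen Da)).
have le : B (refl a x') a <= -1.
  have := dom_form rb rx ry xy; rewrite -(wact_form rb _ _ os') -/x' yE'.
  have aa := basis_norm rb Da.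
  by rewrite /reflection linearBl /= symformZl aa; lra.
have [t ot tP] := antidominant (root_refl Da rx') (simple_refl_pos rb Da rx' Cx' xa)
  ra (cone_gen Da) le.
(* The word r moves y to a, then to -a, and then applies the descent, so r (x - y) is
   antidominant. *)
pose r := t ++ a :: rev s.
have or : over r by apply/over_cat; split=> //; exact/over_cons.
have rE : wact r (x - y) = wact t (refl a x' + a).
  rewrite linearB /= !wact_cat !wact_cons -/x' yE' -linearB /=.
  by rewrite refl_self ?opprK // (basis_norm rb).
exists (inversions B r) => b rb' Cb pos; apply: (inversionsP rb) => //.
have [Crb|//] := root_dichotomy rb (root_wact or rb').
by have := tP _ Crb; rewrite -rE (wact_form rb) //; lra.
Qed.

End Antidominant.

(** * The Coxeter group *)

Section CoxeterGroupWords.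
Context {R : realType} {V : lmodType R} {D : coxeter_datum V}.
Variable W : coxeter_group D.
Local Notation B := (cox_form D).
Local Notation Delta := (cox_basis D).
Local Notation rb := (cox_basisP D).

Lemma cox_act_word (w : W) :
  exists2 s, word_over Delta s & cox_act w =1 word_act B s.
Proof.
have [gen _ _] := cox_systemP W.
pose H : {pred W} := [pred w | `[< exists2 s, word_over Delta s &
  cox_act w =1 word_act B s >]].
suff : w \in H by move/asboolP.
apply: gen => [|a Da].
  split=> [|g h /asboolP[s os sE] /asboolP[t ot tE]].
    by apply/asboolP; exists [::] => // v; rewrite cox_act1.
  apply/asboolP; exists (s ++ rev t).
    by apply/over_cat; split=> //; exact: over_rev.
  move=> v; rewrite cox_actM wact_cat sE; congr word_act.
  by rewrite -[LHS](wact_revK rb _ ot) -tE -cox_actM mulgV cox_act1.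
apply/asboolP; exists [:: a]; first exact/over_cons.
by move=> v; rewrite cox_act_refl.
Qed.

Lemma word_cox_act s : word_over Delta s ->
  exists w : W, cox_act w =1 word_act B s.
Proof.
elim: s => [|a s IH]; first by exists 1%g => v; rewrite cox_act1.
move=> /over_cons[Da /IH[w wE]]; exists (cox_refl W a * w)%g => v.
by rewrite cox_actM wE cox_act_refl.
Qed.

Lemma cox_rootE x : cox_root W x <-> is_root B Delta x.
Proof.
split=> [[w [a [Da ->]]]|[s [a [os Da ->]]]].
  by have [s os sE] := cox_act_word w; exists s, a; rewrite sE.
by have [w wE] := word_cox_act os; exists w, a; rewrite wE.
Qed.

Lemma pos_rootE x : pos_root W x <-> is_root B Delta x /\ cone Delta x.
Proof.
split=> [[/cox_rootE rx /plc_cone Cx]//|[rx Cx]]; split; first exact/cox_rootE.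
by have [/(root_neq0 rb rx)|] := cone_plc Cx.
Qed.

Lemma neg_rootE x : is_root B Delta x -> neg_root W x <-> cone Delta (- x).
Proof.
move=> rx; split=> [[y /pos_rootE[_ Cy] <-]|Cn]; first by rewrite opprK.
exists (- x); last exact: opprK.
by apply/pos_rootE; split=> //; exact: root_opp rb _ rx.
Qed.

Lemma dominates_word x y : is_root B Delta x -> is_root B Delta y ->
  dominates W x y -> word_dominates B Delta x y.
Proof.
move=> rx ry xy s os Cx; have [w wE] := word_cox_act os.
have rw z : is_root B Delta z -> is_root B Delta (cox_act w z).
  by rewrite wE; exact: root_wact.
rewrite -wE; apply/(neg_rootE (rw _ ry)); apply: xy; apply/neg_rootE => //.
  exact: rw.
by rewrite wE.
Qed.

End CoxeterGroupWords.

Theorem theorem4p13 (R : realType) (V : lmodType R) (D : coxeter_datum V)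
    (W : coxeter_group D) (x y : V) :
  cox_root W x -> cox_root W y -> dominates W x y -> imaginary_cone W (x - y).
Proof.
move=> /cox_rootE rx /cox_rootE ry /(dominates_word rx ry) xy.
have rb := cox_basisP D.
have Sxy : x - y \in span_pred D.
  by rewrite rpredB //; apply/span_predP; [exact: root_in_span rx|exact: root_in_span ry].
exists (SpanSpace Sxy) => //; split.
  move=> _ [w _ [f f0 <-]].
  have [s os sE] := cox_act_word w^-1%g.
  (* Extends [f] to [V] by f 0 = 0 off the span. *)
  pose F u := f (insubd 0 u).
  have FE (v : span_space D) : F (val v) = f v by rewrite /F valKd.
  have FL : linear_on_span (cox_basis D) F.
    move=> k u v /span_predP Su /span_predP Sv.
    rewrite -[u](insubdK (0 : span_space D)) // -[v](insubdK (0 : span_space D)) //.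
    by rewrite -linearP !FE linearP.
  have F0 a : cox_basis D a -> 0 <= F a.
    move=> Da; have Sa : a \in span_pred D by apply/span_predP; exact: basis_in_span.
    apply: f0; rewrite insubdK //.
    left; have [a0|//] := cone_plc (cone_gen Da).
    by case: (root_neq0 rb (basis_root _ Da)).
  (* (w f)(x - y) = f (w^-1 (x - y)), and w^-1 preserves dominance. *)
  have le := dom_le rb FL F0 (root_wact os rx) (root_wact os ry) (dom_wact os xy).
  have -> : dual_act w f (SpanSpace Sxy) = F (word_act (cox_form D) s (x - y)).
    by rewrite -sE; exact: (esym (FE (span_act w^-1%g (SpanSpace Sxy)))).
  rewrite linearB addrC -scaleN1r FL /= ?mulN1r 1?addrC ?subr_ge0 //.
    exact: root_in_span (root_wact os ry).
  exact: root_in_span (root_wact os rx).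
have [L LP] := dom_form_finite rb rx ry xy.
apply: (sub_finite_set (B := [set` L])) (finite_seq L) => a [/pos_rootE[ra Ca]].
by move=> /negP; rewrite -ltNge => /(LP a ra Ca).
Qed.
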